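(* The class of integral means of the first kind is minimal and complete. That is: (minimality) if $M_1,M_2$ are integral means of the first kind with $Q_{M_1}=Q_{M_2}$, then $M_1=M_2$; (completeness) for every infinitely differentiable function $u:(0,+\infty)\to\mathbb{R}$ there exists an integral mean of the first kind $M$ with $Q_M=u$.
   Context: A mean is a function $M:(0,+\infty)^2\to(0,+\infty)$ of class $C^\infty$ such that $\min(x,y)\le M(x,y)\le\max(x,y)$ and $M(x,y)=M(y,x)$ for all $x,y>0$. The characteristic function of a mean $M$ is $Q_M:(0,+\infty)\to\mathbb{R}$, $Q_M(x):=\frac{\partial^2 M}{\partial x^2}(x,x)$ (second partial derivative with respect to the first variable, evaluated at $(x,x)$). A mean $M$ is an integral mean of the first kind if there is a strictly monotonic and infinitely differentiable function $f:(0,+\infty)\to\mathbb{R}$ such that $M(x,y)=f^{-1}\left(\frac{1}{y-x}\int_x^y f(t)\,dt\right)$ for all $x,y>0$ with $x\ne y$. *)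

(* Defs.v *)
From Stdlib Require Import Reals.
From Coquelicot Require Import Coquelicot.
Local Open Scope R_scope.

(* Functions on (0,+oo) and (0,+oo)^2 are represented by total functions on R
   and R^2 of which only the values at positive arguments are ever constrained
   or compared.  Derivatives at a positive point depend only on such values. *)

Definition smooth_pos (f : R -> R) : Prop :=
  forall (n : nat) (x : R), 0 < x -> ex_derive_n f n x.

(* [ex_diff_n M n x y]: all iterated partial derivatives of M up to order n
   exist and are continuous at (x,y); required on the whole open quadrant and
   for all n, this is class C^oo. *)
Definition smooth2_pos (M : R -> R -> R) : Prop :=
  forall (n : nat) (x y : R), 0 < x -> 0 < y -> ex_diff_n M n x y.

Definition strictly_monotonic_pos (f : R -> R) : Prop :=
  (forall x y, 0 < x -> x < y -> f x < f y) \/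
  (forall x y, 0 < x -> x < y -> f y < f x).

Record is_mean (M : R -> R -> R) : Prop := {
  mean_pos : forall x y, 0 < x -> 0 < y -> 0 < M x y;
  mean_smooth : smooth2_pos M;
  mean_bounds : forall x y, 0 < x -> 0 < y -> Rmin x y <= M x y <= Rmax x y;
  mean_sym : forall x y, 0 < x -> 0 < y -> M x y = M y x
}.

Definition charfun (M : R -> R -> R) (x : R) : R :=
  Derive_n (fun t => M t x) 2 x.

(* This determines g on the image f((0,+oo)), where it is the inverse of f. *)
Definition inverse_pos (f g : R -> R) : Prop :=
  forall x, 0 < x -> g (f x) = x.

(* For x, y > 0 with x <> y, the average of f between x and y belongs to the
   image f((0,+oo)) because f is continuous, so g is only used where it is
   the inverse of f. *)
Definition integral_mean_first_kind (M : R -> R -> R) : Prop :=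
  is_mean M /\
  exists f g : R -> R,
    strictly_monotonic_pos f /\ smooth_pos f /\ inverse_pos f g /\
    forall x y, 0 < x -> 0 < y -> x <> y ->
      M x y = g (1 / (y - x) * RInt f x y).

Definition minimal_class (C : (R -> R -> R) -> Prop) : Prop :=
  forall M1 M2 : R -> R -> R, C M1 -> C M2 ->
    (forall x, 0 < x -> charfun M1 x = charfun M2 x) ->
    forall x y, 0 < x -> 0 < y -> M1 x y = M2 x y.

Definition complete_class (C : (R -> R -> R) -> Prop) : Prop :=
  forall u : R -> R, smooth_pos u ->
    exists M : R -> R -> R, C M /\ forall x, 0 < x -> charfun M x = u x.

(* Main.v *)
Require Import Defs.
From Stdlib Require Import Reals.
From Coquelicot Require Import Coquelicot.
From Stdlib Require Import Lra Lia Ranalysis5.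
Local Open Scope R_scope.

(** Let [M] be the integral mean generated by [f] and let [F' = f].  Wherever
    [x <> y], the mean value theorem turns the defining formula into the
    implicit equation [f (M x y) * (y - x) = F y - F x], with [M x y] strictly
    between [x] and [y].  Fixing [y = a] and differentiating three times at
    [x = a] gives [M x a = a + (x - a) / 2 + q (x - a)^2 / 2 + o((x - a)^2)] with
    [f''(a) = 12 f'(a) q] and [q] the characteristic function at [a]
    ([charfun_mean_value]).

    Solving for [q] requires [f'(a) <> 0], which strict monotonicity alone does
    not provide: [(t - 1)^3] is strictly increasing.  Smoothness of [M] excludes
    this case.  Differentiating the implicit equation in [x] shows that
    [f'(M x y)] times a real number is [(f x - f (M x y)) / (x - y)], which is
    nonzero off the diagonal, and every [a > 0] is a value of [M] off the
    diagonal ([generator_derive_neq_0]).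

    Hence [12 Q = f'' / f'] determines [f] up to [f |-> c f + d], and such a
    change does not affect [M]: this is minimality.

    Conversely, given [u], let [f' = exp (12 U)] with [U' = u].  Then
    [M = g o A], where [g] inverts [f] and [A x y] is the integral of
    [f ((1 - s) x + s y)] over [0 <= s <= 1].  Written over a fixed interval,
    [A] is smooth across the diagonal by differentiation under the integral
    sign.  The partial derivatives of [M] are those of [A] multiplied by
    [exp (-12 U) o M], so [M] gains one order of differentiability at each step
    of an induction and is smooth ([generated_diff2_n]).  Its characteristic
    function is then [u] by the formula above. *)

(** * Calculus on the half-line *)

Lemma locally_pos x : 0 < x -> locally x (fun t => 0 < t).
Proof. intros Hx. now apply (open_gt 0 x). Qed.

Lemma is_derive_Rmult (f g : R -> R) x df dg :
  is_derive f x df -> is_derive g x dg ->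
  is_derive (fun t => f t * g t) x (df * g x + f x * dg).
Proof. intros Hf Hg. apply (is_derive_mult f g x df dg Hf Hg Rmult_comm). Qed.

Lemma is_derive_Rplus (f g : R -> R) x df dg :
  is_derive f x df -> is_derive g x dg ->
  is_derive (fun t => f t + g t) x (df + dg).
Proof. intros Hf Hg. apply (is_derive_plus f g x df dg Hf Hg). Qed.

Lemma is_derive_Rcomp (f g : R -> R) x df dg :
  is_derive f (g x) df -> is_derive g x dg ->
  is_derive (fun t => f (g t)) x (df * dg).
Proof.
intros Hf Hg. rewrite Rmult_comm. apply (is_derive_comp f g x df dg Hf Hg).
Qed.

Lemma is_derive_continuity_pt (f : R -> R) x l :
  is_derive f x l -> continuity_pt f x.
Proof.
intros H. apply derivable_continuous_pt. exists l. now apply is_derive_Reals.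
Qed.

Lemma is_derive_continuous (f : R -> R) x l : is_derive f x l -> continuous f x.
Proof. intros H. apply @ex_derive_continuous. now exists l. Qed.

Lemma is_derive_eq_pos (f g : R -> R) x l l' :
  (forall t, 0 < t -> f t = g t) -> 0 < x ->
  is_derive f x l -> is_derive g x l' -> l = l'.
Proof.
intros E Hx Hf Hg.
assert (Hg' : is_derive g x l).
{ apply (is_derive_ext_loc f); [|exact Hf].
  apply (filter_imp (fun t => 0 < t)); [exact E | now apply locally_pos]. }
now rewrite <- (is_derive_unique _ _ _ Hg'), <- (is_derive_unique _ _ _ Hg).
Qed.

Lemma MVT_pos (f f' : R -> R) a b :
  (forall x, 0 < x -> is_derive f x (f' x)) -> 0 < a -> a < b ->
  exists c, f b - f a = f' c * (b - a) /\ a < c < b.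
Proof.
intros H Ha Hab. apply MVT_cor2; [exact Hab|].
intros c Hc. apply is_derive_Reals, H; lra.
Qed.

Lemma is_derive_zero_const (f : R -> R) a b :
  (forall x, 0 < x -> is_derive f x 0) -> 0 < a -> 0 < b -> f a = f b.
Proof.
intros H.
assert (L : forall a b, 0 < a -> a < b -> f a = f b).
{ intros x y Hx Hxy.
  destruct (MVT_pos f (fun _ => 0) x y H Hx Hxy) as [c [Hc _]]. lra. }
intros Ha Hb. destruct (Rtotal_order a b) as [h|[h|h]].
- now apply L.
- now subst.
- symmetry; now apply L.
Qed.

Lemma primitive_pos (f : R -> R) :
  (forall x, 0 < x -> continuous f x) ->
  exists F, forall x, 0 < x -> is_derive F x (f x).
Proof.
intros Hf. exists (fun x => RInt f 1 x). intros x Hx.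
apply (is_derive_RInt f _ 1); [|now apply Hf].
apply (filter_imp (fun t => 0 < t)); [|now apply locally_pos].
intros t Ht. apply (RInt_correct f), (ex_RInt_continuous f).
intros z [Hz _]. apply Hf. apply Rlt_le_trans with (2 := Hz).
apply Rmin_case; lra.
Qed.

Lemma RInt_primitive (f F : R -> R) a b :
  (forall x, 0 < x -> is_derive F x (f x)) ->
  (forall x, 0 < x -> continuous f x) ->
  0 < a -> 0 < b -> is_RInt f a b (F b - F a).
Proof.
intros HF Hf Ha Hb.
assert (P : forall x, Rmin a b <= x <= Rmax a b -> 0 < x).
{ intros x [Hx _]. apply Rlt_le_trans with (2 := Hx). apply Rmin_case; lra. }
apply (is_RInt_derive F f); intros x Hx; [apply HF | apply Hf]; now apply P.
Qed.

(** * Smooth functions of one and two positive variables *)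

(** Recursive forms of differentiability up to order [n] on the positive
    half-line and quadrant.  The derivatives are existential witnesses
    constrained only at positive arguments, so that algebraic closure properties
    follow by induction without computing with [Derive]. *)
Fixpoint diff_n (n : nat) (f : R -> R) : Prop :=
  match n with
  | O => True
  | S n => exists f', (forall x, 0 < x -> is_derive f x (f' x)) /\ diff_n n f'
  end.

Fixpoint diff2_n (n : nat) (M : R -> R -> R) : Prop :=
  (forall x y, 0 < x -> 0 < y -> continuity_2d_pt M x y) /\
  match n with
  | O => True
  | S n => exists Mx My,
      (forall x y, 0 < x -> 0 < y -> is_derive (fun z => M z y) x (Mx x y)) /\
      (forall x y, 0 < x -> 0 < y -> is_derive (fun z => M x z) y (My x y)) /\
      diff2_n n Mx /\ diff2_n n My
  end.

Lemma diff_n_weaken n f : diff_n (S n) f -> diff_n n f.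
Proof.
revert f. induction n as [|n IH]; intros f; [easy|].
intros [f' [Hf Hn]]. exists f'. split; [exact Hf|]. now apply IH.
Qed.

Lemma diff_n_ext n f g :
  (forall x, 0 < x -> f x = g x) -> diff_n n f -> diff_n n g.
Proof.
intros E. destruct n as [|n].
{ easy. }
intros [f' [Hf Hn]]. exists f'. split; [|exact Hn].
intros x Hx. apply (is_derive_ext_loc f); [|now apply Hf].
apply (filter_imp (fun t => 0 < t)); [exact E | now apply locally_pos].
Qed.

Lemma diff_n_const n c : diff_n n (fun _ => c).
Proof.
revert c. induction n as [|n IH]; intros c; [easy|].
exists (fun _ => 0). split; [intros x _; apply @is_derive_const | apply IH].
Qed.

Lemma diff_n_plus n f g :
  diff_n n f -> diff_n n g -> diff_n n (fun x => f x + g x).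
Proof.
revert f g. induction n as [|n IH]; intros f g; [easy|].
intros [f' [Hf Hnf]] [g' [Hg Hng]]. exists (fun x => f' x + g' x). split.
- intros x Hx. apply is_derive_Rplus; auto.
- now apply IH.
Qed.

Lemma diff_n_mult n f g :
  diff_n n f -> diff_n n g -> diff_n n (fun x => f x * g x).
Proof.
revert f g. induction n as [|n IH]; intros f g; [easy|].
intros Hf0 Hg0. pose proof (diff_n_weaken _ _ Hf0). pose proof (diff_n_weaken _ _ Hg0).
destruct Hf0 as [f' [Hf Hnf]]. destruct Hg0 as [g' [Hg Hng]].
exists (fun x => f' x * g x + f x * g' x). split.
- intros x Hx. apply is_derive_Rmult; auto.
- apply diff_n_plus; now apply IH.
Qed.

Lemma smooth_pos_Derive f : smooth_pos f -> smooth_pos (Derive f).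
Proof.
intros H [|n] x Hx; [exact I|].
apply (ex_derive_ext (Derive_n f (S n))); [|now apply (H (S (S n)))].
intros t. change (Derive f) with (Derive_n f 1).
rewrite Derive_n_comp. f_equal. lia.
Qed.

Lemma smooth_pos_diff_n f : smooth_pos f -> forall n, diff_n n f.
Proof.
intros H n. revert f H. induction n as [|n IH]; intros f H; [easy|].
exists (Derive f). split.
- intros x Hx. apply Derive_correct. now apply (H 1%nat).
- now apply IH, smooth_pos_Derive.
Qed.

Lemma diff_n_ex_derive_n n f :
  diff_n n f -> forall x, 0 < x -> ex_derive_n f n x.
Proof.
revert f. induction n as [|n IH]; intros f; [easy|].
intros [f' [Hf Hn]] x Hx.
destruct n as [|n]; [exists (f' x); now apply Hf|].
(* The derivatives of [f] agree with those of [f'] only on the half-line. *)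
apply (ex_derive_ext_loc (Derive_n f' n)); [|now apply (IH f' Hn)].
apply (filter_imp (fun t => 0 < t)); [|now apply locally_pos].
intros t Ht. replace (S n) with (n + 1)%nat by lia.
rewrite <- Derive_n_comp. apply Derive_n_ext_loc.
apply (filter_imp (fun t => 0 < t)); [|now apply locally_pos].
intros s Hs. symmetry. apply is_derive_unique. now apply Hf.
Qed.

Lemma diff_n_smooth_pos f : (forall n, diff_n n f) -> smooth_pos f.
Proof. intros H n x Hx. now apply diff_n_ex_derive_n. Qed.

Lemma diff2_n_continuity n M x y :
  diff2_n n M -> 0 < x -> 0 < y -> continuity_2d_pt M x y.
Proof. destruct n; intros [H _]; apply H. Qed.

Lemma diff2_n_weaken n M : diff2_n (S n) M -> diff2_n n M.
Proof.
revert M. induction n as [|n IH]; intros M [C H]; [now split|].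
split; [exact C|]. destruct H as [Mx [My [Hx [Hy [Nx Ny]]]]].
exists Mx, My. split; [exact Hx|split; [exact Hy|split; now apply IH]].
Qed.

Lemma diff2_n_plus n M N :
  diff2_n n M -> diff2_n n N -> diff2_n n (fun x y => M x y + N x y).
Proof.
revert M N. induction n as [|n IH]; intros M N HM HN.
all: split; [intros x y Hx Hy; apply continuity_2d_pt_plus;
               eapply diff2_n_continuity; eauto|].
{ easy. }
destruct HM as [_ [Mx [My [HMx [HMy [? ?]]]]]].
destruct HN as [_ [Nx [Ny [HNx [HNy [? ?]]]]]].
exists (fun x y => Mx x y + Nx x y), (fun x y => My x y + Ny x y).
split; [|split; [|split]].
- intros x y Hx Hy. apply is_derive_Rplus; auto.
- intros x y Hx Hy. apply is_derive_Rplus; auto.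
- now apply IH.
- now apply IH.
Qed.

Lemma diff2_n_mult n M N :
  diff2_n n M -> diff2_n n N -> diff2_n n (fun x y => M x y * N x y).
Proof.
revert M N. induction n as [|n IH]; intros M N HM HN.
all: split; [intros x y Hx Hy; apply continuity_2d_pt_mult;
               eapply diff2_n_continuity; eauto|].
{ easy. }
pose proof (diff2_n_weaken _ _ HM). pose proof (diff2_n_weaken _ _ HN).
destruct HM as [_ [Mx [My [HMx [HMy [? ?]]]]]].
destruct HN as [_ [Nx [Ny [HNx [HNy [? ?]]]]]].
exists (fun x y => Mx x y * N x y + M x y * Nx x y),
       (fun x y => My x y * N x y + M x y * Ny x y).
split; [|split; [|split]].
- intros x y Hx Hy. apply (is_derive_Rmult (fun z => M z y) (fun z => N z y)); auto.
- intros x y Hx Hy. apply (is_derive_Rmult (M x) (N x)); auto.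
- apply diff2_n_plus; now apply IH.
- apply diff2_n_plus; now apply IH.
Qed.

(** One more derivative of [f] than of the composite is available, so that the
    continuity of its last derivative comes for free. *)
Lemma diff2_n_comp n f M :
  diff_n (S n) f -> diff2_n n M ->
  (forall x y, 0 < x -> 0 < y -> 0 < M x y) ->
  diff2_n n (fun x y => f (M x y)).
Proof.
revert f M. induction n as [|n IH]; intros f M Hf HM P.
all: destruct Hf as [f' [Hf Hf']].
all: split; [intros x y Hx Hy; apply continuity_1d_2d_pt_comp;
  [eapply is_derive_continuity_pt, Hf; auto
  |eapply diff2_n_continuity; eauto]|].
{ easy. }
pose proof (diff2_n_weaken _ _ HM).
destruct HM as [_ [Mx [My [HMx [HMy [? ?]]]]]].
exists (fun x y => f' (M x y) * Mx x y), (fun x y => f' (M x y) * My x y).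
split; [|split; [|split]].
- intros x y Hx Hy. apply (is_derive_Rcomp f (fun z => M z y)); auto.
- intros x y Hx Hy. apply (is_derive_Rcomp f (M x)); auto.
- apply diff2_n_mult; auto.
- apply diff2_n_mult; auto.
Qed.

Lemma locally_2d_pos x y :
  0 < x -> 0 < y -> locally_2d (fun u v => 0 < u /\ 0 < v) x y.
Proof.
intros Hx Hy. exists (mkposreal _ (Rmin_pos x y Hx Hy)). simpl.
intros u v Hu Hv. apply Rabs_def2 in Hu, Hv.
pose proof (Rmin_l x y). pose proof (Rmin_r x y). lra.
Qed.

Lemma diff2_n_ex_diff_n n M :
  diff2_n n M -> forall x y, 0 < x -> 0 < y -> ex_diff_n M n x y.
Proof.
revert M. induction n as [|n IH]; intros M [C H] x y Hx Hy.
all: split; [now apply C|].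
{ easy. }
destruct H as [Mx [My [HMx [HMy [Nx Ny]]]]].
split; [|split; [|split]].
- exists (Mx x y). now apply HMx.
- exists (My x y). now apply HMy.
- apply (ex_diff_n_ext_loc Mx); [|now apply IH].
  apply (locally_2d_impl_strong (fun u v => 0 < u /\ 0 < v)); [|now apply locally_2d_pos].
  apply locally_2d_forall. intros u v L. apply locally_2d_singleton in L.
  symmetry. apply is_derive_unique. now apply HMx.
- apply (ex_diff_n_ext_loc My); [|now apply IH].
  apply (locally_2d_impl_strong (fun u v => 0 < u /\ 0 < v)); [|now apply locally_2d_pos].
  apply locally_2d_forall. intros u v L. apply locally_2d_singleton in L.
  symmetry. apply is_derive_unique. now apply HMy.
Qed.

Lemma smooth2_pos_slice M a n :
  smooth2_pos M -> 0 < a -> diff_n n (fun t => M t a).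
Proof.
intros HM Ha. revert M HM. induction n as [|n IH]; intros M HM; [easy|].
exists (fun t => Derive (fun z => M z a) t). split.
- intros x Hx. apply Derive_correct. now apply (HM 1%nat x a).
- apply (IH (fun u v => Derive (fun z => M z v) u)).
  intros k x y Hx Hy. now apply (HM (S k) x y).
Qed.

(** * Weighted averages *)

(** The bound by 1 is preserved by products, hence by repeated
    differentiation of [average], and it lets a bound on the integrand's
    oscillation carry over to the integral with no further constant. *)
Definition weight (w : R -> R) : Prop :=
  (forall s, continuous w s) /\ forall s, 0 <= s <= 1 -> 0 <= w s <= 1.

(** The family of integrals closed under both partial derivatives: each one
    differentiates [f] and multiplies the weight [w] by [p] or [q]. *)
Definition average (p q w f : R -> R) (x y : R) : R :=
  RInt (fun s => w s * f (p s * x + q s * y)) 0 1.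

Lemma weight_mult v w : weight v -> weight w -> weight (fun s => v s * w s).
Proof.
intros [Cv Bv] [Cw Bw]. split.
- intros s. now apply (continuous_mult v w).
- intros s Hs. specialize (Bv s Hs). specialize (Bw s Hs). nra.
Qed.

Section Average.

Variables p q : R -> R.
Hypothesis Hp : weight p.
Hypothesis Hq : weight q.
Hypothesis Hpq : forall s, p s + q s = 1.

Lemma average_arg_bounds s x y lo hi :
  0 <= s <= 1 -> lo <= x <= hi -> lo <= y <= hi ->
  lo <= p s * x + q s * y <= hi.
Proof.
intros Hs Hx Hy. pose proof (proj2 Hp s Hs). pose proof (proj2 Hq s Hs).
pose proof (Hpq s). replace (q s) with (1 - p s) in * by lra. nra.
Qed.

Lemma average_arg_pos s x y :
  0 <= s <= 1 -> 0 < x -> 0 < y -> 0 < p s * x + q s * y.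
Proof.
intros Hs Hx Hy. apply Rlt_le_trans with (Rmin x y); [now apply Rmin_pos|].
apply (average_arg_bounds s x y _ (Rmax x y) Hs); split;
  auto using Rmin_l, Rmin_r, Rmax_l, Rmax_r.
Qed.

Lemma average_integrand_continuous w f s x y :
  weight w -> (forall t, 0 < t -> continuous f t) ->
  0 <= s <= 1 -> 0 < x -> 0 < y ->
  continuous (fun s => w s * f (p s * x + q s * y)) s.
Proof.
intros [Cw _] Cf Hs Hx Hy.
apply (continuous_mult w (fun s => f (p s * x + q s * y))); [apply Cw|].
apply (continuous_comp (fun s => p s * x + q s * y) f).
- apply (continuous_plus (fun s => p s * x) (fun s => q s * y));
    apply @continuous_mult; try apply continuous_const; [apply Hp|apply Hq].
- now apply Cf, average_arg_pos.
Qed.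

Lemma ex_RInt_average w f x y :
  weight w -> (forall t, 0 < t -> continuous f t) -> 0 < x -> 0 < y ->
  ex_RInt (fun s => w s * f (p s * x + q s * y)) 0 1.
Proof.
intros Hw Cf Hx Hy. apply (ex_RInt_continuous (fun s => w s * f (p s * x + q s * y))).
rewrite Rmin_left, Rmax_right by lra. intros s Hs.
now apply average_integrand_continuous.
Qed.

(** As [p + q = 1] with [p, q >= 0], moving [x] and [y] by less than [d] moves
    every argument of [f] by less than [d], within a compact part of the
    half-line; uniform continuity of [f] there suffices. *)
Lemma average_continuity w f x y :
  weight w -> (forall t, 0 < t -> continuous f t) -> 0 < x -> 0 < y ->
  continuity_2d_pt (average p q w f) x y.
Proof.
intros Hw Cf Hx Hy eps.
(* Perturbations smaller than [lo] keep all arguments of [f] in [lo, hi]. *)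
set (lo := Rmin x y / 2). set (hi := Rmax x y + lo).
assert (Hlo : 0 < lo) by (unfold lo; pose proof (Rmin_pos x y Hx Hy); lra).
assert (Bx : 2 * lo <= x <= hi - lo)
  by (unfold hi, lo; pose proof (Rmin_l x y); pose proof (Rmax_l x y); lra).
assert (By : 2 * lo <= y <= hi - lo)
  by (unfold hi, lo; pose proof (Rmin_r x y); pose proof (Rmax_r x y); lra).
destruct (unifcont_normed_1d f lo hi) with (eps := pos_div_2 eps) as [d Hd].
{ intros t Ht. apply Cf. lra. }
exists (mkposreal _ (Rmin_pos d lo (cond_pos d) Hlo)). simpl.
intros u v Hu Hv.
pose proof (Rmin_l d lo). pose proof (Rmin_r d lo).
pose proof (Rabs_def2 _ _ Hu). pose proof (Rabs_def2 _ _ Hv).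
assert (Eu : ex_RInt (fun s => w s * f (p s * u + q s * v)) 0 1)
  by (apply ex_RInt_average; auto; lra).
assert (Ex : ex_RInt (fun s => w s * f (p s * x + q s * y)) 0 1)
  by (apply ex_RInt_average; auto).
unfold average.
assert (E := RInt_minus (V := R_CompleteNormedModule) _ _ _ _ Eu Ex).
change minus with Rminus in E. simpl in E. 
apply Rle_lt_trans with ((1 - 0) * (eps / 2)); [|pose proof (cond_pos eps); lra].
replace (RInt _ 0 1 - RInt _ 0 1) with
  (RInt (fun s => w s * f (p s * u + q s * v) - w s * f (p s * x + q s * y)) 0 1)
  by exact E.
apply abs_RInt_le_const; [lra | exact (ex_RInt_minus (V := R_NormedModule) _ _ _ _ Eu Ex)|].
intros s Hs. rewrite <- Rmult_minus_distr_l, Rabs_mult.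
pose proof (proj2 Hw s Hs) as Bw. rewrite (Rabs_pos_eq (w s)) by lra.
assert (D : Rabs (f (p s * u + q s * v) - f (p s * x + q s * y)) < eps / 2).
{ apply (Hd (p s * x + q s * y) (p s * u + q s * v)).
  - apply average_arg_bounds; auto; lra.
  - apply average_arg_bounds; auto; lra.
  - change (Rabs ((p s * u + q s * v) - (p s * x + q s * y)) < d).
    replace ((p s * u + q s * v) - (p s * x + q s * y))
      with (p s * (u - x) + q s * (v - y)) by ring.
    set (m := Rmin d lo) in *.
    pose proof (average_arg_bounds s (u - x) (v - y)
      (Rmin (u - x) (v - y)) (Rmax (u - x) (v - y)) Hs) as B.
    assert (- m < Rmin (u - x) (v - y)) by (apply Rmin_glb_lt; lra).
    assert (Rmax (u - x) (v - y) < m) by (apply Rmax_lub_lt; lra).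
    pose proof (Rmin_l (u - x) (v - y)). pose proof (Rmin_r (u - x) (v - y)).
    pose proof (Rmax_l (u - x) (v - y)). pose proof (Rmax_r (u - x) (v - y)).
    apply Rabs_def1; lra. }
pose proof (Rabs_pos (f (p s * u + q s * v) - f (p s * x + q s * y))). nra.
Qed.

Lemma average_derive w (f f' : R -> R) x y :
  weight w ->
  (forall t, 0 < t -> is_derive f t (f' t)) ->
  (forall t, 0 < t -> continuous f' t) -> 0 < x -> 0 < y ->
  is_derive (fun z => average p q w f z y) x
    (average p q (fun s => w s * p s) f' x y).
Proof.
intros Hw Hf Cf' Hx Hy.
assert (Cf : forall t, 0 < t -> continuous f t)
  by (intros t Ht; eapply is_derive_continuous; now apply Hf).
assert (D : forall s u, 0 < p s * u + q s * y ->
  is_derive (fun z => w s * f (p s * z + q s * y)) u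
    ((w s * p s) * f' (p s * u + q s * y))).
{ intros s u Hs. rewrite Rmult_assoc. apply is_derive_scal. rewrite (Rmult_comm (p s)).
  apply (is_derive_Rcomp f); [now apply Hf|].
  auto_derive; [easy|ring]. }
unfold average.
replace (RInt (fun s => w s * p s * f' (p s * x + q s * y)) 0 1) with
  (RInt (fun s => Derive (fun z => w s * f (p s * z + q s * y)) x) 0 1).
- apply (is_derive_RInt_param (fun z s => w s * f (p s * z + q s * y))).
  + apply (filter_imp (fun t => 0 < t)); [|now apply locally_pos].
    rewrite Rmin_left, Rmax_right by lra. intros u Hu s Hs.
    eexists. now apply D, average_arg_pos.
  + rewrite Rmin_left, Rmax_right by lra. intros s Hs.
    assert (P := average_arg_pos s x y Hs Hx Hy).
    assert (C1 : forall h, continuous h s -> continuity_2d_pt (fun _ v => h v) x s).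
    { intros h Hh. apply (continuity_1d_2d_pt_comp h (fun _ v => v));
        [now apply continuity_pt_filterlim | apply continuity_2d_pt_id2]. }
    assert (CA : continuity_2d_pt (fun u v => p v * u + q v * y) x s).
    { apply continuity_2d_pt_plus; apply continuity_2d_pt_mult.
      - apply C1, Hp.
      - apply continuity_2d_pt_id1.
      - apply C1, Hq.
      - apply continuity_2d_pt_const. }
    apply (continuity_2d_pt_ext_loc
      (fun u v => (w v * p v) * f' (p v * u + q v * y))).
    * destruct (CA (mkposreal _ P)) as [d Hd]. exists d. intros u v Hu Hv.
      specialize (Hd u v Hu Hv). simpl in Hd. apply Rabs_def2 in Hd.
      symmetry. apply is_derive_unique, D. lra.
    * apply continuity_2d_pt_mult; [apply continuity_2d_pt_mult|].
      -- apply C1, Hw.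
      -- apply C1, Hp.
      -- apply continuity_1d_2d_pt_comp; [|exact CA].
         apply continuity_pt_filterlim. now apply Cf'.
  + apply (filter_imp (fun t => 0 < t)); [|now apply locally_pos].
    intros u Hu. now apply ex_RInt_average.
- apply RInt_ext. rewrite Rmin_left, Rmax_right by lra. intros s Hs.
  apply is_derive_unique, D, average_arg_pos; lra.
Qed.

End Average.

(** Reduces the second partial derivative to the first. *)
Lemma average_swap p q w f x y : average p q w f x y = average q p w f y x.
Proof. apply RInt_ext. intros s _. now rewrite Rplus_comm. Qed.

Lemma average_diff2_n p q n w f :
  weight p -> weight q -> (forall s, p s + q s = 1) ->
  weight w -> diff_n (S n) f -> diff2_n n (average p q w f).
Proof.
intros Hp Hq Hpq. revert w f. induction n as [|n IH]; intros w f Hw [f' [Hf Hn]].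
all: split; [intros x y Hx Hy; apply average_continuity; auto;
  intros t Ht; eapply is_derive_continuous; now apply Hf|].
{ easy. }
assert (Cf' : forall t, 0 < t -> continuous f' t).
{ destruct Hn as [f2 [Hf2 _]]. intros t Ht. eapply is_derive_continuous; now apply Hf2. }
exists (average p q (fun s => w s * p s) f'), (average p q (fun s => w s * q s) f').
split; [|split; [|split]].
- intros x y Hx Hy. now apply average_derive.
- intros x y Hx Hy. rewrite average_swap.
  apply (is_derive_ext (fun z => average q p w f z x));
    [intros z; apply average_swap|].
  apply average_derive; auto. intros s. rewrite Rplus_comm. apply Hpq.
- apply IH; [now apply weight_mult|exact Hn].
- apply IH; [now apply weight_mult|exact Hn].
Qed.

(** * Integral means as implicit functions *)

Definition represents (f g : R -> R) (M : R -> R -> R) : Prop :=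
  forall x y, 0 < x -> 0 < y -> x <> y -> M x y = g (1 / (y - x) * RInt f x y).

(** The form of the defining equation that no longer mentions the inverse of
    [f]; it can be differentiated directly. *)
Definition mean_value (F f : R -> R) (M : R -> R -> R) : Prop :=
  forall x y, 0 < x -> 0 < y -> x <> y ->
    Rmin x y < M x y < Rmax x y /\ f (M x y) * (y - x) = F y - F x.

Lemma represents_mean_value (F f g : R -> R) M :
  (forall x, 0 < x -> is_derive F x (f x)) ->
  (forall x, 0 < x -> continuous f x) ->
  inverse_pos f g -> represents f g M -> mean_value F f M.
Proof.
intros HF Cf Hg HM x y Hx Hy Hxy. rewrite (HM x y Hx Hy Hxy).
rewrite (is_RInt_unique _ _ _ _ (RInt_primitive f F x y HF Cf Hx Hy)).
assert (H : exists c, Rmin x y < c < Rmax x y /\ F y - F x = f c * (y - x)).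
{ destruct (Rtotal_order x y) as [h|[h|h]]; [|easy|].
  - destruct (MVT_pos F f x y HF Hx h) as [c [Hc Bc]]. exists c.
    rewrite Rmin_left, Rmax_right by lra. now split.
  - destruct (MVT_pos F f y x HF Hy h) as [c [Hc Bc]]. exists c.
    rewrite Rmin_right, Rmax_left by lra. split; [easy|]. lra. }
destruct H as [c [Bc Hc]].
assert (0 < c) by (pose proof (Rmin_pos x y Hx Hy); lra).
replace (1 / (y - x) * (F y - F x)) with (f c) by (rewrite Hc; field; lra).
rewrite Hg by assumption. split; [exact Bc | now symmetry].
Qed.

Lemma mean_diag M x : is_mean M -> 0 < x -> M x x = x.
Proof.
intros HM Hx. pose proof (mean_bounds M HM x x Hx Hx) as B.
rewrite Rmin_left, Rmax_left in B by lra. lra.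
Qed.

(** Crossing the diagonal is avoided: for [b > a] close to [a], the slice
    [s |-> M s b] passes from below [a] at [a / 2] to above [a] at [a], by
    continuity of [M (a / 2)] at [a]. *)
Lemma mean_value_onto (F f : R -> R) M a :
  is_mean M -> mean_value F f M -> 0 < a ->
  exists x y, 0 < x /\ 0 < y /\ x <> y /\ M x y = a.
Proof.
intros HM V Ha.
assert (C : forall b t, 0 < b -> 0 < t -> continuity_pt (fun s => M s b) t).
{ intros b t Hb Ht.
  destruct (smooth2_pos_slice M b 1 (mean_smooth M HM) Hb) as [m' [Hm _]].
  eapply is_derive_continuity_pt. now apply Hm. }
assert (B : M (a / 2) a < a).
{ destruct (V (a / 2) a) as [B _]; try lra. rewrite Rmax_right in B by lra. lra. }
assert (Hb : exists b, a < b /\ M (a / 2) b < a).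
{ assert (C2 := C (a / 2) a ltac:(lra) Ha).
  destruct (proj1 (continuity_pt_locally _ _) C2 (mkposreal (a - M (a / 2) a) ltac:(lra))) as [d Hd].
  pose proof (cond_pos d). exists (a + d / 2). split; [lra|].
  assert (D := Hd (a + d / 2)). simpl in D.
  rewrite (mean_sym M HM _ (a / 2)), (mean_sym M HM a (a / 2)) in D by lra.
  assert (Bd : ball a d (a + d / 2)).
  { change (Rabs (a + d / 2 - a) < d). rewrite Rabs_pos_eq; lra. }
  apply D, Rabs_def2 in Bd. lra. }
destruct Hb as [b [Hab Hb]].
assert (Hu : a < M a b).
{ destruct (V a b) as [Bu _]; try lra. rewrite Rmin_left in Bu by lra. lra. }
destruct (f_interv_is_interv (fun s => M s b) (a / 2) a a) as [x [Hx E]].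
{ lra. }
{ lra. }
{ intros x Hx. apply C; lra. }
exists x, b. split; [lra|split; [lra|split; [lra|exact E]]].
Qed.

(** Multiplied out, the equation also holds on the diagonal, so it may be
    differentiated there. *)
Lemma mean_value_slice (F f : R -> R) M a :
  is_mean M -> (forall x, 0 < x -> is_derive F x (f x)) -> mean_value F f M ->
  0 < a -> forall t, 0 < t -> f (M t a) * (t - a) = F t - F a.
Proof.
intros HM HF V Ha t Ht. destruct (Req_dec t a) as [->|Hta]; [ring|].
destruct (V t a Ht Ha Hta) as [_ E]. lra.
Qed.

(** If [f' a = 0], pick [x <> y] with [M x y = a].  Differentiating
    [f (M t y) * (t - y) = F t - F y] at [t = x] leaves [f a = f x], so [a = x];
    but [M x y] lies strictly between [x] and [y]. *)
Lemma generator_derive_neq_0 (F f f1 : R -> R) M a :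
  is_mean M ->
  (forall x, 0 < x -> is_derive F x (f x)) ->
  (forall x, 0 < x -> is_derive f x (f1 x)) ->
  (forall x y, 0 < x -> 0 < y -> f x = f y -> x = y) ->
  mean_value F f M -> 0 < a -> f1 a <> 0.
Proof.
intros HM HF Hf Inj V Ha Z.
destruct (mean_value_onto F f M a HM V Ha) as [x [y [Hx [Hy [Hxy E]]]]].
destruct (smooth2_pos_slice M y 1 (mean_smooth M HM) Hy) as [m' [Hm _]].
assert (D : (f1 (M x y) * m' x) * (x - y) + f (M x y) * 1 = f x).
{ apply (is_derive_eq_pos (fun t => f (M t y) * (t - y)) (fun t => F t - F y) x).
  - now apply (mean_value_slice F f M).
  - exact Hx.
  - apply (is_derive_Rmult (fun t => f (M t y)) (fun t => t - y)).
    + apply (is_derive_Rcomp f (fun t => M t y)); [|now apply Hm].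
      apply Hf. now apply mean_pos.
    + auto_derive; [easy|ring].
  - replace (f x) with (f x + 0) by ring.
    apply (is_derive_Rplus F (fun _ => - F y)); [now apply HF|].
    apply @is_derive_const. }
rewrite E, Z in D.
assert (a = x) by (apply Inj; auto; lra).
destruct (V x y Hx Hy Hxy) as [B _]. rewrite E in B.
destruct (Rle_dec x y); [rewrite Rmin_left in B by lra | rewrite Rmax_left in B by lra]; lra.
Qed.

(** With [k t = f (M t a)], the equation [k t * (t - a) = F t - F a] yields
    [2 k' = f'] and [3 k'' = f''] at [a].  The first gives [m' a = 1 / 2] for
    [m t = M t a], and then the second reads [3 (f'' / 4 + f' m'') = f'']. *)
Lemma charfun_mean_value (F f f1 f2 : R -> R) M a :
  is_mean M -> smooth_pos f ->
  (forall x, 0 < x -> is_derive F x (f x)) ->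
  (forall x, 0 < x -> is_derive f x (f1 x)) ->
  (forall x, 0 < x -> is_derive f1 x (f2 x)) ->
  mean_value F f M -> 0 < a -> f1 a <> 0 ->
  f2 a = 12 * f1 a * charfun M a.
Proof.
intros HM Sf HF Hf Hf1 V Ha N.
assert (Hf2 : exists f3, forall x, 0 < x -> is_derive f2 x (f3 x)).
{ destruct (smooth_pos_diff_n f Sf 3) as [g1 [Hg1 [g2 [Hg2 [g3 [Hg3 _]]]]]].
  assert (E1 : forall x, 0 < x -> g1 x = f1 x).
  { intros x Hx. apply (is_derive_eq_pos f f x); auto. }
  assert (E2 : forall x, 0 < x -> g2 x = f2 x).
  { intros x Hx. apply (is_derive_eq_pos g1 f1 x); auto. }
  exists g3. intros x Hx. apply (is_derive_ext_loc g2); [|auto].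
  apply (filter_imp (fun t => 0 < t)); [exact E2 | now apply locally_pos]. }
destruct Hf2 as [f3 Hf2].
destruct (smooth2_pos_slice M a 3 (mean_smooth M HM) Ha)
  as [m1 [Hm [m2 [Hm1 [m3 [Hm2 _]]]]]].
pose (m := fun t => M t a). change (fun t => M t a) with m in Hm.
assert (Pm : forall t, 0 < t -> 0 < m t) by (intros; now apply mean_pos).
assert (Em : m a = a) by now apply mean_diag.
assert (EQ : charfun M a = m2 a).
{ unfold charfun. simpl. apply is_derive_unique.
  apply (is_derive_ext_loc m1); [|now apply Hm1].
  apply (filter_imp (fun t => 0 < t)); [|now apply locally_pos].
  intros t Ht. symmetry. apply is_derive_unique. now apply Hm. }
rewrite EQ.
pose (k := fun t => f (m t)).
pose (k1 := fun t => f1 (m t) * m1 t).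
pose (k2 := fun t => (f2 (m t) * m1 t) * m1 t + f1 (m t) * m2 t).
assert (Hk : forall t, 0 < t -> is_derive k t (k1 t)).
{ intros t Ht. apply (is_derive_Rcomp f m); auto. }
assert (Hk1 : forall t, 0 < t -> is_derive k1 t (k2 t)).
{ intros t Ht. apply (is_derive_Rmult (fun t => f1 (m t)) m1); [|auto].
  apply (is_derive_Rcomp f1 m); auto. }
assert (Hk2 : exists k3, forall t, 0 < t -> is_derive k2 t (k3 t)).
{ exists (fun t => (((f3 (m t) * m1 t) * m1 t + f2 (m t) * m2 t) * m1 t
                     + (f2 (m t) * m1 t) * m2 t)
                    + ((f2 (m t) * m1 t) * m2 t + f1 (m t) * m3 t)).
  intros t Ht.
  apply (is_derive_Rplus (fun t => (f2 (m t) * m1 t) * m1 t) (fun t => f1 (m t) * m2 t)).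
  - apply (is_derive_Rmult (fun t => f2 (m t) * m1 t) m1); [|auto].
    apply (is_derive_Rmult (fun t => f2 (m t)) m1); [|auto].
    apply (is_derive_Rcomp f2 m); auto.
  - apply (is_derive_Rmult (fun t => f1 (m t)) m2); [|auto].
    apply (is_derive_Rcomp f1 m); auto. }
destruct Hk2 as [k3 Hk2].
assert (Lin : forall t, is_derive (fun t => t - a) t 1)
  by (intros t; auto_derive; [easy|ring]).
assert (D1 : forall t, 0 < t -> k1 t * (t - a) + k t * 1 = f t + 0).
{ intros t Ht.
  apply (is_derive_eq_pos (fun t => k t * (t - a)) (fun t => F t + - F a) t);
    [now apply (mean_value_slice F f M)|exact Ht| |].
  - apply (is_derive_Rmult k (fun t => t - a)); auto.
  - apply (is_derive_Rplus F (fun _ => - F a)); [auto|apply @is_derive_const]. }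
assert (D2 : forall t, 0 < t -> (k2 t * (t - a) + k1 t * 1) + k1 t = f1 t).
{ intros t Ht.
  apply (is_derive_eq_pos (fun t => k1 t * (t - a) + k t) f t); [|exact Ht| |auto].
  - intros s Hs. specialize (D1 s Hs). lra.
  - apply (is_derive_Rplus (fun t => k1 t * (t - a)) k); [|auto].
    apply (is_derive_Rmult k1 (fun t => t - a)); auto. }
assert (D3 : (k3 a * (a - a) + k2 a * 1) + 2 * k2 a = f2 a).
{ apply (is_derive_eq_pos (fun t => k2 t * (t - a) + 2 * k1 t) f1 a); [|exact Ha| |auto].
  - intros s Hs. specialize (D2 s Hs). lra.
  - apply (is_derive_Rplus (fun t => k2 t * (t - a)) (fun t => 2 * k1 t)).
    + apply (is_derive_Rmult k2 (fun t => t - a)); auto.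
    + apply is_derive_scal; auto. }
specialize (D2 a Ha). unfold k1, k2 in *. rewrite Em in D2, D3.
assert (X : m1 a = 1 / 2) by (apply (Rmult_eq_reg_l (f1 a)); lra).
rewrite X in D3. lra.
Qed.

(** * Minimality *)

Lemma strictly_monotonic_pos_inj f x y :
  strictly_monotonic_pos f -> 0 < x -> 0 < y -> f x = f y -> x = y.
Proof.
intros H Hx Hy E. destruct (Rtotal_order x y) as [h|[h|h]]; [|exact h|];
  exfalso; destruct H as [H|H].
- specialize (H x y Hx h). lra.
- specialize (H x y Hx h). lra.
- specialize (H y x Hy h). lra.
- specialize (H y x Hy h). lra.
Qed.

Lemma integral_mean_generator M :
  integral_mean_first_kind M ->
  exists F f f1 f2 : R -> R,
    (forall x, 0 < x -> is_derive F x (f x)) /\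
    (forall x, 0 < x -> is_derive f x (f1 x)) /\
    (forall x, 0 < x -> is_derive f1 x (f2 x)) /\
    (forall x y, 0 < x -> 0 < y -> f x = f y -> x = y) /\
    mean_value F f M /\
    forall x, 0 < x -> f1 x <> 0 /\ f2 x = 12 * f1 x * charfun M x.
Proof.
intros [HM [f [g [Mf [Sf [Hg HR]]]]]].
destruct (smooth_pos_diff_n f Sf 2) as [f1 [Hf [f2 [Hf1 _]]]].
assert (Cf : forall x, 0 < x -> continuous f x)
  by (intros x Hx; eapply is_derive_continuous; now apply Hf).
destruct (primitive_pos f Cf) as [F HF].
assert (V := represents_mean_value F f g M HF Cf Hg HR).
assert (Inj : forall x y, 0 < x -> 0 < y -> f x = f y -> x = y)
  by (intros; now apply (strictly_monotonic_pos_inj f)).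
exists F, f, f1, f2.
do 4 (split; [assumption|]). split; [exact V|]. intros x Hx. split.
- now apply (generator_derive_neq_0 F f f1 M).
- apply (charfun_mean_value F f f1 f2 M); auto.
  now apply (generator_derive_neq_0 F f f1 M).
Qed.

(** Equal characteristic functions make [f' / g'] constant, so that
    [f = c g + d]; the means then satisfy the same implicit equation. *)
Lemma integral_means_minimal : minimal_class integral_mean_first_kind.
Proof.
intros M N HM HN Q x y Hx Hy.
destruct (Req_dec x y) as [<-|Hxy].
{ now rewrite (mean_diag M), (mean_diag N) by (apply HM || apply HN || exact Hx). }
destruct (integral_mean_generator M HM) as [F [f [f1 [f2 [HF [Hf [Hf1 [If [VM Df]]]]]]]]].
destruct (integral_mean_generator N HN) as [G [g [g1 [g2 [HG [Hg [Hg1 [Ig [VN Dg]]]]]]]]].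
assert (C1 : exists c, forall t, 0 < t -> f1 t = c * g1 t).
{ exists (f1 1 * / g1 1). intros t Ht.
  rewrite <- (is_derive_zero_const (fun t => f1 t * / g1 t) t 1); try lra.
  - field. now apply Dg.
  - intros s Hs. destruct (Df s Hs) as [Nf Ef]. destruct (Dg s Hs) as [Ng Eg].
    replace 0 with (f2 s * / g1 s + f1 s * (- g2 s / g1 s ^ 2)).
    + apply (is_derive_Rmult f1 (fun t => / g1 t)); [auto|].
      apply is_derive_inv; auto.
    + rewrite Ef, Eg, (Q s Hs). field. exact Ng. }
destruct C1 as [c C1].
assert (C0 : exists d, forall t, 0 < t -> f t = c * g t + d).
{ exists (f 1 + - c * g 1). intros t Ht.
  rewrite <- (is_derive_zero_const (fun t => f t + - c * g t) t 1); try lra.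
  intros s Hs. replace 0 with (f1 s + - c * g1 s) by (rewrite C1 by exact Hs; ring).
  apply (is_derive_Rplus f (fun t => - c * g t)); [auto|].
  apply is_derive_scal; auto. }
destruct C0 as [d C0].
assert (PM : 0 < M x y) by now apply HM.
assert (PN : 0 < N x y) by now apply HN.
destruct (VM x y Hx Hy Hxy) as [_ EM]. destruct (VN x y Hx Hy Hxy) as [_ EN].
apply If; auto.
apply (Rmult_eq_reg_r (y - x)); [|lra].
rewrite EM, (C0 (N x y) PN), Rmult_plus_distr_r, Rmult_assoc, EN.
assert (E := is_derive_zero_const (fun t => F t + (- c * G t + - d * t)) x y).
simpl in E. enough (F x + (- c * G x + - d * x) = F y + (- c * G y + - d * y)) by lra.
apply E; auto. intros t Ht.
replace 0 with (f t + (- c * g t + - d * 1)) by (rewrite C0 by exact Ht; ring).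
apply (is_derive_Rplus F (fun t => - c * G t + - d * t)); [auto|].
apply (is_derive_Rplus (fun t => - c * G t) (fun t => - d * t));
  apply is_derive_scal; [auto|apply @is_derive_id].
Qed.

(** * Completeness *)

(** A supremum gives the inverse explicitly, whatever the range of [f]. *)
Lemma increasing_pos_left_inverse (f : R -> R) :
  (forall x y, 0 < x -> x < y -> f x < f y) -> exists g, inverse_pos f g.
Proof.
intros H. exists (fun b => real (Lub_Rbar (fun t => 0 < t /\ f t <= b))).
intros x Hx. rewrite (is_lub_Rbar_unique _ (Finite x)); [easy|]. split.
- intros t [Ht Ft]. simpl. destruct (Rle_dec t x); [easy|].
  assert (f x < f t) by (apply H; lra). lra.
- intros b Hb. apply Hb. split; lra.
Qed.

Lemma left_inverse_derive (f f1 g : R -> R) x :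
  (forall x, 0 < x -> is_derive f x (f1 x)) ->
  (forall x y, 0 < x -> x < y -> f x < f y) ->
  inverse_pos f g -> 0 < x -> f1 x <> 0 ->
  is_derive g (f x) (/ f1 x).
Proof.
intros Hf Inc Hg Hx N.
assert (Cf : forall a, 0 < a -> continuity_pt f a)
  by (intros a Ha; eapply is_derive_continuity_pt; now apply Hf).
assert (L : f (x / 2) < f x < f (2 * x)) by (split; apply Inc; lra).
assert (Cg : continuity_pt g (f x)).
{ apply (continuity_pt_recip_prelim f g (x / 2) (2 * x)); try lra.
  - intros s t Hs Hst _. apply Inc; lra.
  - intros s Hs. apply (Hg s); lra.
  - intros s Hs. apply Cf; lra. }
assert (Prf : forall a, g (f (x / 2)) <= a <= g (f (2 * x)) -> derivable_pt f a).
{ intros a Ha. rewrite !Hg in Ha by lra. exists (f1 a). apply is_derive_Reals, Hf; lra. }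
assert (B : g (f (x / 2)) <= g (f x) <= g (f (2 * x))) by (rewrite !Hg; lra).
assert (E : derive_pt f (g (f x)) (Prf (g (f x)) B) = f1 x).
{ apply derive_pt_eq_0. rewrite Hg by exact Hx. now apply is_derive_Reals, Hf. }
assert (D := derivable_pt_lim_recip_interv f g _ _ (f x) Prf Cg ltac:(lra) L B).
rewrite E in D. apply is_derive_Reals. replace (/ f1 x) with (1 / f1 x) by (field; exact N).
apply D; [|exact N].
intros z Hz. unfold comp, id.
destruct (f_interv_is_interv f (x / 2) (2 * x) z) as [s [Hs <-]]; try lra.
- intros s Hs. apply Cf; lra.
- rewrite Hg; lra.
Qed.

(** The derivative of [h = exp (c U)] is [c u h], so each differentiability
    order of [h] yields the next one. *)
Lemma exp_primitive_diff_n u U c n :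
  (forall k, diff_n k u) -> (forall x, 0 < x -> is_derive U x (u x)) ->
  diff_n n (fun x => exp (c * U x)).
Proof.
intros Su HU. induction n as [|n IH]; [easy|].
exists (fun x => exp (c * U x) * (c * u x)). split.
- intros x Hx. apply (is_derive_Rcomp exp (fun x => c * U x)).
  + apply is_derive_Reals, derivable_pt_lim_exp.
  + apply is_derive_scal; auto.
- apply diff_n_mult; [exact IH|]. apply diff_n_mult; [|apply Su].
  apply diff_n_const.
Qed.

(** The average of [f] between [x] and [y], in a form without a singularity at
    [x = y]. *)
Definition interval_average (f : R -> R) : R -> R -> R :=
  average (fun s => 1 - s) (fun s => s) (fun _ => 1) f.

Lemma weight_1 : weight (fun _ => 1).
Proof. split; [intros; apply continuous_const|intros; lra]. Qed.

Lemma weight_id : weight (fun s => s).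
Proof. split; [intros; apply continuous_id|intros; lra]. Qed.

Lemma weight_1_minus : weight (fun s => 1 - s).
Proof.
split; [|intros; lra]. intros s.
apply (continuous_minus (fun _ => 1) (fun s => s));
  [apply continuous_const | apply continuous_id].
Qed.

Lemma interval_average_diff2_n f n :
  diff_n (S n) f -> diff2_n n (interval_average f).
Proof.
apply average_diff2_n; auto using weight_1, weight_id, weight_1_minus.
intros; ring.
Qed.

Lemma interval_average_diag f x : interval_average f x x = f x.
Proof.
unfold interval_average, average.
rewrite (RInt_ext _ (fun _ => f x)).
- rewrite RInt_const. change ((1 - 0) * f x = f x). ring.
- intros s _. rewrite Rmult_1_l. f_equal. ring.
Qed.

Lemma interval_average_RInt (f : R -> R) x y :
  (forall t, 0 < t -> continuous f t) -> 0 < x -> 0 < y -> x <> y ->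
  interval_average f x y = 1 / (y - x) * RInt f x y.
Proof.
intros Cf Hx Hy Hxy. unfold interval_average, average.
rewrite (RInt_ext _ (fun s => f ((y - x) * s + x)))
  by (intros s _; rewrite Rmult_1_l; f_equal; ring).
assert (E := RInt_comp_lin f (y - x) x 0 1).
replace ((y - x) * 0 + x) with x in E by ring.
replace ((y - x) * 1 + x) with y in E by ring.
assert (P : forall z, Rmin x y <= z -> 0 < z)
  by (intros z Hz; pose proof (Rmin_pos x y Hx Hy); lra).
rewrite <- E.
- rewrite (RInt_scal (V := R_CompleteNormedModule) (fun s => f ((y - x) * s + x))).
  + change (scal (y - x) ?r) with ((y - x) * r).
    generalize (RInt (fun s => f ((y - x) * s + x)) 0 1 : R). simpl.
    intros r. field. lra.
  + apply (ex_RInt_continuous (fun s => f ((y - x) * s + x))).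
    rewrite Rmin_left, Rmax_right by lra. intros s Hs.
    apply (continuous_comp (fun s => (y - x) * s + x) f).
    * apply (is_derive_continuous _ _ (y - x)). auto_derive; [easy|ring].
    * apply Cf. nra.
- apply (ex_RInt_continuous f). intros z [Hz _]. auto.
Qed.

Section Construction.

Variables f f1 g : R -> R.
Hypothesis Sf : forall n, diff_n n f.
Hypothesis Hf : forall x, 0 < x -> is_derive f x (f1 x).
Hypothesis f1_pos : forall x, 0 < x -> 0 < f1 x.
Hypothesis Sinv : forall n, diff_n n (fun x => / f1 x).
Hypothesis Hg : inverse_pos f g.

Let M x y := g (interval_average f x y).

Lemma generator_continuous x : 0 < x -> continuous f x.
Proof. intros Hx. eapply is_derive_continuous; now apply Hf. Qed.

Lemma generator_increasing x y : 0 < x -> x < y -> f x < f y.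
Proof.
intros Hx Hxy. destruct (MVT_pos f f1 x y Hf Hx Hxy) as [c [E Hc]].
assert (0 < f1 c) by (apply f1_pos; lra). nra.
Qed.

Lemma generated_represents : represents f g M.
Proof.
intros x y Hx Hy Hxy. unfold M. rewrite interval_average_RInt; auto.
apply generator_continuous.
Qed.

Lemma generated_bounds x y : 0 < x -> 0 < y ->
  Rmin x y <= M x y <= Rmax x y /\ f (M x y) = interval_average f x y.
Proof.
intros Hx Hy. destruct (Req_dec x y) as [<-|Hxy].
- unfold M. rewrite interval_average_diag, Hg by exact Hx.
  rewrite Rmin_left, Rmax_left by lra. lra.
- destruct (primitive_pos f generator_continuous) as [F HF].
  destruct (represents_mean_value F f g M HF generator_continuous Hg
    generated_represents x y Hx Hy Hxy) as [B E].
  split; [lra|]. rewrite interval_average_RInt by (auto using generator_continuous).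
  rewrite (is_RInt_unique _ _ _ _ (RInt_primitive f F x y HF generator_continuous Hx Hy)).
  rewrite <- E. field. lra.
Qed.

Lemma generated_pos x y : 0 < x -> 0 < y -> 0 < M x y.
Proof.
intros Hx Hy. destruct (generated_bounds x y Hx Hy) as [B _].
pose proof (Rmin_pos x y Hx Hy). lra.
Qed.

Lemma generated_g_derive x y : 0 < x -> 0 < y ->
  is_derive g (interval_average f x y) (/ f1 (M x y)).
Proof.
intros Hx Hy. assert (P := generated_pos x y Hx Hy).
rewrite <- (proj2 (generated_bounds x y Hx Hy)).
apply left_inverse_derive; auto using generator_increasing.
apply Rgt_not_eq, f1_pos, P.
Qed.

(** The derivative of [g] at [A x y] is [/ f' (M x y)], which is as regular as
    [M] itself because [/ f'] is smooth: [M] of class [n] has partial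
    derivatives of class [n], without studying higher derivatives of [g]. *)
Lemma generated_diff2_n n : diff2_n n M.
Proof.
induction n as [|n IH].
all: split; [intros x y Hx Hy; apply (continuity_1d_2d_pt_comp g);
  [eapply is_derive_continuity_pt; now apply generated_g_derive
  |eapply diff2_n_continuity; eauto; now apply (interval_average_diff2_n f 0)]|].
{ easy. }
destruct (interval_average_diff2_n f (S n) (Sf _)) as [_ [Ax [Ay [HAx [HAy [Nx Ny]]]]]].
assert (I : diff2_n n (fun x y => / f1 (M x y)))
  by (apply (diff2_n_comp n (fun t => / f1 t)); auto using generated_pos).
exists (fun x y => / f1 (M x y) * Ax x y), (fun x y => / f1 (M x y) * Ay x y).
split; [|split; [|split]].
- intros x y Hx Hy. apply (is_derive_Rcomp g (fun z => interval_average f z y)); auto.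
  now apply generated_g_derive.
- intros x y Hx Hy. apply (is_derive_Rcomp g (interval_average f x)); auto.
  now apply generated_g_derive.
- now apply diff2_n_mult.
- now apply diff2_n_mult.
Qed.

Lemma generated_integral_mean : integral_mean_first_kind M.
Proof.
split; [split|].
- apply generated_pos.
- intros n. apply diff2_n_ex_diff_n, generated_diff2_n.
- intros x y Hx Hy. now apply generated_bounds.
- intros x y Hx Hy. destruct (Req_dec x y) as [<-|Hxy]; [easy|].
  rewrite !generated_represents by auto. f_equal.
  rewrite <- (opp_RInt_swap (V := R_CompleteNormedModule)).
  + change (opp ?r) with (- r). field. lra.
  + apply (ex_RInt_continuous f). intros z [Hz _]. apply generator_continuous.
    pose proof (Rmin_pos y x Hy Hx). lra.
- exists f, g. split; [left; exact generator_increasing|].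
  split; [now apply diff_n_smooth_pos|]. split; [exact Hg|exact generated_represents].
Qed.

End Construction.

Lemma integral_means_complete : complete_class integral_mean_first_kind.
Proof.
intros u Su. assert (Du := smooth_pos_diff_n u Su).
assert (Cont : forall h, diff_n 1 h -> forall x, 0 < x -> continuous h x).
{ intros h [h' [Hh _]] x Hx. eapply is_derive_continuous; now apply Hh. }
destruct (primitive_pos u (Cont u (Du 1%nat))) as [U HU].
pose (f1 := fun x => exp (12 * U x)).
assert (Sf1 : forall n, diff_n n f1)
  by (intros n; now apply (exp_primitive_diff_n u)).
destruct (primitive_pos f1 (Cont f1 (Sf1 1%nat))) as [f Hf].
assert (Sf : forall n, diff_n n f) by (intros [|n]; [easy|]; now exists f1).
assert (P1 : forall x, 0 < x -> 0 < f1 x) by (intros; apply exp_pos).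
assert (Si : forall n, diff_n n (fun x => / f1 x)).
{ intros n. apply (diff_n_ext n (fun x => exp (-12 * U x))).
  - intros x _. unfold f1. rewrite <- exp_Ropp. f_equal. ring.
  - now apply (exp_primitive_diff_n u). }
destruct (increasing_pos_left_inverse f (generator_increasing f f1 Hf P1)) as [g Hg].
assert (HM := generated_integral_mean f f1 g Sf Hf P1 Si Hg).
exists (fun x y => g (interval_average f x y)). split; [exact HM|].
intros x Hx.
assert (Hf1 : forall x, 0 < x -> is_derive f1 x (f1 x * (12 * u x))).
{ intros t Ht. apply (is_derive_Rcomp exp (fun x => 12 * U x)).
  - apply is_derive_Reals, derivable_pt_lim_exp.
  - apply is_derive_scal; auto. }
destruct (primitive_pos f (Cont f (Sf 1%nat))) as [F HF].
assert (P := P1 x Hx).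
assert (E := charfun_mean_value F f f1 (fun x => f1 x * (12 * u x)) _ x (proj1 HM)
  (diff_n_smooth_pos f Sf) HF Hf Hf1
  (represents_mean_value F f g _ HF (Cont f (Sf 1%nat)) Hg
     (generated_represents f f1 g Hf)) Hx ltac:(lra)).
simpl in E. apply (Rmult_eq_reg_l (12 * f1 x)); lra.
Qed.

Theorem corollary3p25 :
  minimal_class integral_mean_first_kind /\
  complete_class integral_mean_first_kind.
Proof.
exact (conj integral_means_minimal integral_means_complete).
Qed.
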